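(* For every integer $N\ge 1$, the cosine measure of the set $D_3\subset\mathbb{R}^N$ is $$\mathrm{cm}(D_3)=\frac{1}{\sqrt{\sum_{j=1}^{N}\left(\sqrt{j}-\sqrt{j-1}\right)^2}}.$$
   Context: For a finite set $D\subset\mathbb{R}^N$ that positively spans $\mathbb{R}^N$ (every vector of $\mathbb{R}^N$ is a linear combination of elements of $D$ with nonnegative coefficients), the cosine measure is $$\mathrm{cm}(D)=\min_{0\neq v\in\mathbb{R}^N}\ \max_{0\neq d\in D}\ \frac{v^T d}{\|v\|_2\,\|d\|_2}.$$ The set $D_3$ is $$D_3=\Big\{d^{(k)}\in\mathbb{R}^N \ :\ d^{(k)}_l=[\mathrm{radix}_3(k)]_l-1,\ 1\le l\le N,\ 0\le k\le 3^N-1\Big\},$$ where $\mathrm{radix}_3(k)\in\{0,1,2\}^N$ is the vector of the $N$ base-3 digits of the integer $k$ and $[\mathrm{radix}_3(k)]_l$ its $l$-th component. Equivalently, $D_3=\{-1,0,1\}^N$ (the zero vector is excluded from the maximum in the cosine measure). *)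

(* Defs.v *)
From HB Require Import structures.
From mathcomp Require Import all_boot all_order all_algebra.
From mathcomp Require Import finmap.
From mathcomp Require Import all_classical all_reals.

Set Implicit Arguments.
Unset Strict Implicit.
Unset Printing Implicit Defensive.

Import Order.TTheory GRing.Theory Num.Theory.

Local Open Scope classical_set_scope.
Local Open Scope ring_scope.

(* The minimum and maximum of a set of reals. They are genuine (attained)
   extrema when these exist, and take the junk value 0 otherwise. *)
Definition set_min (R : realType) (A : set R) : R :=
  xget 0 [set m | A m /\ lbound A m].

Definition set_max (R : realType) (A : set R) : R :=
  xget 0 [set m | A m /\ ubound A m].

Definition dot (R : realType) (N : nat) (v d : 'cV[R]_N) : R :=
  (v^T *m d) ord0 ord0.

(* The library norm `|v| on matrices is the sup norm, hence this definition. *)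
Definition norm2 (R : realType) (N : nat) (v : 'cV[R]_N) : R :=
  Num.sqrt (\sum_(l < N) v l ord0 ^+ 2).

Definition cosine (R : realType) (N : nat) (v d : 'cV[R]_N) : R :=
  dot v d / (norm2 v * norm2 d).

Definition positively_spans (R : realType) (N : nat)
    (D : {fset 'cV[R]_N}) : Prop :=
  forall v : 'cV[R]_N, exists c : 'cV[R]_N -> R,
    (forall d, 0 <= c d) /\ v = \sum_(d <- D) c d *: d.

(* Meaningful for finite sets D that positively span R^N, with 0 < N; the inner
   maximum then ranges over a nonempty finite set. *)
Definition cm (R : realType) (N : nat) (D : {fset 'cV[R]_N}) : R :=
  set_min [set set_max [set cosine v d | d in [set d | d \in D /\ d != 0]]
          | v in [set v : 'cV[R]_N | v != 0]].

(* The components of vectors are indexed from 0, so that the digit of index l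
   is the coefficient of 3 ^ l, least significant digit first. *)
Definition radix3 (k l : nat) : nat := ((k %/ 3 ^ l) %% 3)%N.

Definition D3_vec (R : realType) (N k : nat) : 'cV[R]_N :=
  \col_(l < N) ((radix3 k l)%:R - 1).

Definition D3 (R : realType) (N : nat) : {fset 'cV[R]_N} :=
  [fset D3_vec R N (val k) | k in 'I_(3 ^ N)]%fset.

Lemma radix3_surj (N : nat) (x : nat -> nat) : (forall l, x l < 3)%N ->
  exists2 k, (k < 3 ^ N)%N & forall l, (l < N)%N -> radix3 k l = x l.
Proof.
elim: N x => [|N IH] x hx; first by exists 0%N.
have [k hk ek] := IH (fun l => x l.+1) (fun l => hx l.+1).
exists (k * 3 + x 0)%N.
  rewrite expnS mulnC (@leq_trans (3 * k.+1)%N) //.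
    by rewrite mulnSr [(3 * k)%N]mulnC ltn_add2l.
  by rewrite leq_mul2l.
case=> [_|l hl]; rewrite /radix3.
  by rewrite expn0 divn1 modnMDl modn_small.
by rewrite expnS divnMA divnMDl // (divn_small (hx 0%N)) addn0 -ek.
Qed.

Lemma mem_D3 (R : realType) (N : nat) (d : 'cV[R]_N) :
  (d \in D3 R N) = [forall l, d l ord0 \in [:: -1; 0; 1]].
Proof.
apply/imfsetP/forallP => [[k _ ->] l|hd].
  rewrite mxE !inE; have : (radix3 k l < 3)%N by rewrite ltn_mod.
  case: (radix3 k l) => [|[|[|n]]] // _.
  - by rewrite sub0r eqxx.
  - by rewrite subrr eqxx orbT.
  - by rewrite -[2%:R]/(1 + 1) addrK eqxx !orbT.
pose x (l : nat) : nat := if insub l is Some i then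
  if d i ord0 == -1 then 0%N else if d i ord0 == 0 then 1%N else 2%N
  else 0%N.
have hx l : (x l < 3)%N by rewrite /x; case: insub => // i; do 2?case: ifP.
have [k hk ek] := radix3_surj N hx.
exists (Ordinal hk) => //=; apply/colP => l; rewrite mxE ek // /x valK.
have := hd l; rewrite !inE.
case: eqVneq => [->|_] /=; first by rewrite sub0r.
case: eqVneq => [->|_] /=; first by rewrite subrr.
by move=> /eqP ->; rewrite -[2%:R]/(1 + 1) addrK.
Qed.

Lemma D3_positively_spans (R : realType) (N : nat) :
  positively_spans (D3 R N).
Proof.
pose P (v : 'cV[R]_N) := exists c : 'cV[R]_N -> R,
  (forall d, 0 <= c d) /\ v = \sum_(d <- D3 R N) c d *: d.
have P0 : P 0.
  by exists (fun=> 0); split=> //; rewrite big1 // => d _; rewrite scale0r.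
have PD u v : P u -> P v -> P (u + v).
  move=> [a [a0 ->]] [b [b0 ->]]; exists (fun d => a d + b d); split.
    by move=> d; rewrite addr_ge0.
  by rewrite -big_split; apply: eq_bigr => d _; rewrite scalerDl.
have PZ a d : 0 <= a -> d \in D3 R N -> P (a *: d).
  move=> a0 dD; exists (fun e => if e == d then a else 0); split.
    by move=> e; case: ifP.
  rewrite (big_fsetD1 d) //= eqxx big1_seq ?addr0 // => e /=.
  by rewrite !inE => /andP[/negPf -> _]; rewrite scale0r.
move=> v; rewrite -/(P v) [v]matrix_sum_delta.
apply: (big_ind P) => // l _; rewrite big_ord1.
have hD (s : R) : s \in [:: -1; 1] -> s *: delta_mx l ord0 \in D3 R N.
  move=> hs; rewrite mem_D3; apply/forallP => i; rewrite !mxE andbT !inE.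
  case: (i == l); rewrite ?mulr1 ?mulr0 ?eqxx ?orbT //.
  by move: hs; rewrite !inE => /orP[]->; rewrite ?orbT.
have [v0|v0] := leP 0 (v l ord0).
  by rewrite -[delta_mx _ _]scale1r; apply: PZ => //; apply: hD; rewrite !inE eqxx orbT.
rewrite -[v l ord0]opprK scaleNr -scalerN -scaleN1r; apply: PZ.
  by rewrite oppr_ge0 ltW.
by apply: hD; rewrite !inE eqxx.
Qed.

(* Main.v *)
(* The unit vector along c = (sqrt j - sqrt (j - 1))_j attains the minimum.
   For d in {-1, 0, 1}^N with k nonzero entries, c^T d is at most the sum of the
   k largest entries of c, which telescopes to sqrt k = |d|.
   Conversely, let m be the maximal cosine of v, put M = m |v|, and let
   a_1 >= ... >= a_N be the sorted absolute values of the entries of v. Testing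
   against the signs of the k largest entries gives
   a_1 + ... + a_k <= M sqrt k = M (c_1 + ... + c_k) for all k, hence
   sum a_j^2 <= M sum c_j a_j by Abel summation, and expanding
   0 <= sum (M c_j - a_j)^2 yields |v|^2 <= M^2 |c|^2. *)
Require Import Defs.
From HB Require Import structures.
From mathcomp Require Import all_boot all_order all_fingroup all_algebra.
From mathcomp Require Import finmap.
From mathcomp Require Import all_classical all_reals.
From mathcomp Require Import ring lra.

Import Order.TTheory GRing.Theory Num.Theory.

Local Open Scope classical_set_scope.
Local Open Scope ring_scope.

Lemma set_maxE (R : realType) (A : set R) (m : R) :
  A m -> ubound A m -> set_max A = m.
Proof.
move=> Am ubm; apply: xget_unique => // y [Ay uby].
by apply/le_anti; rewrite uby // ubm.
Qed.

Lemma set_minE (R : realType) (A : set R) (m : R) :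
  A m -> lbound A m -> set_min A = m.
Proof.
move=> Am lbm; apply: xget_unique => // y [Ay lby].
by apply/le_anti; rewrite lby // lbm.
Qed.

Lemma dotE (R : realType) (N : nat) (v d : 'cV[R]_N) :
  dot v d = \sum_(l < N) v l ord0 * d l ord0.
Proof. by rewrite /dot mxE; apply: eq_bigr => l _; rewrite mxE. Qed.

Lemma norm2_gt0 (R : realType) (N : nat) (v : 'cV[R]_N) :
  v != 0 -> 0 < norm2 v.
Proof.
move=> v0; rewrite sqrtr_gt0 lt_neqAle sumr_ge0 ?andbT => [|i _]; last first.
  exact: sqr_ge0.
apply: contraNneq v0 => /esym/eqP.
rewrite psumr_eq0 => [/allP v0|i _]; last exact: sqr_ge0.
apply/eqP/colP => i; rewrite mxE; apply/eqP.
by have := v0 i; rewrite mem_index_enum sqrf_eq0; apply.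
Qed.

(** Sorting the enumeration of the indices by decreasing [f] gives a duplicate-free tuple, whose
    indexing map is the permutation. *)
Lemma sorting_perm (R : realType) (N : nat) (f : 'I_N -> R) :
  exists s : 'S_N, forall i j : 'I_N, (i <= j)%N -> f (s j) <= f (s i).
Proof.
pose r := [rel i j | f j <= f i].
have r_tot : total r by move=> i j; rewrite /r /= le_total.
have r_tr : transitive r by move=> y x z /= xy yz; apply: le_trans yz xy.
have szt : size (sort r (enum 'I_N)) == N by rewrite size_sort size_enum_ord.
pose t := Tuple szt.
have t_inj : injective (tnth t).
  by apply/tuple_uniqP; rewrite sort_uniq enum_uniq.
exists (perm t_inj) => i j ij; rewrite !permE !(tnth_nth i).
by apply: (@sorted_leq_nth _ r r_tr (fun x => lexx (f x)) i _
  (sort_sorted r_tot (enum 'I_N))); rewrite ?inE ?(eqP szt).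
Qed.

(** Abel summation as an induction: lowering the weight of a nonnegative partial sum from [w n] to
    [w n.+1] can only decrease the product. *)
Lemma abel_sum_ge (R : realType) (e w : nat -> R) (n : nat) :
  (forall k, (k < n)%N -> w k.+1 <= w k) ->
  (forall k, (k <= n)%N -> 0 <= \sum_(j < k) e j) ->
  w n * \sum_(j < n.+1) e j <= \sum_(j < n.+1) e j * w j.
Proof.
elim: n => [|n IH] hw he; first by rewrite !big_ord1 mulrC.
rewrite big_ord_recr [leRHS]big_ord_recr /= mulrDr [e _ * _]mulrC lerD2r.
apply: (@le_trans _ _ (w n * \sum_(j < n.+1) e j)).
  by rewrite ler_wpM2r ?he ?hw.
by apply: IH => k kn; [apply: hw; rewrite ltnW | apply: he; rewrite leqW].
Qed.

(** The entries of the extremal vector c, indexed from 0. *)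
Definition sqrt_step (R : realType) (j : nat) : R :=
  Num.sqrt j.+1%:R - Num.sqrt j%:R.

Lemma sqrt_step_ge0 (R : realType) (j : nat) : 0 <= sqrt_step R j.
Proof. by rewrite subr_ge0 ler_sqrt ?ler_nat. Qed.

Lemma sum_sqrt_step (R : realType) (k : nat) :
  \sum_(j < k) sqrt_step R j = Num.sqrt k%:R.
Proof.
elim: k => [|k IH]; first by rewrite big_ord0 sqrtr0.
by rewrite big_ord_recr /= IH /sqrt_step addrC subrK.
Qed.

(** Each step is the reciprocal of sqrt (j + 1) + sqrt j, which increases with j. *)
Lemma sqrt_step_anti (R : realType) (k n : nat) :
  (k <= n)%N -> sqrt_step R n <= sqrt_step R k.
Proof.
move=> kn; rewrite /sqrt_step.
pose r (j : nat) : R := Num.sqrt j%:R.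
have r_mono i j : (i <= j)%N -> r i <= r j.
  by move=> ij; rewrite ler_sqrt ?ler_nat.
have step_mul j : (r j.+1 - r j) * (r j.+1 + r j) = 1.
  by rewrite -subr_sqr !sqr_sqrtr // -natr1 addrAC subrr add0r.
have sum_gt0 j : 0 < r j.+1 + r j by rewrite ltr_pwDl ?sqrtr_ge0 ?sqrtr_gt0.
rewrite -/(r k) -/(r n) -/(r k.+1) -/(r n.+1).
rewrite -(ler_pM2r (sum_gt0 k)) step_mul -(step_mul n) ler_wpM2l //.
  by rewrite subr_ge0 r_mono.
by rewrite lerD ?r_mono.
Qed.

(** If [k] indices below [n] are selected, then k <= n, so a further step at [n] is at most the step
    at [k], which is the growth of the right-hand side. *)
Lemma sum_sqrt_step_le (R : realType) (P : pred nat) (n : nat) :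
  \sum_(j < n | P j) sqrt_step R j <= Num.sqrt (\sum_(j < n) P j)%N%:R.
Proof.
elim: n => [|n IH]; first by rewrite !big_ord0 sqrtr0.
rewrite big_mkcond big_ord_recr -big_mkcond [in leRHS]big_ord_recr /=.
case: (P n); last by rewrite addr0 addn0.
rewrite addn1 -lerBrDr; apply: (le_trans IH).
set k := (\sum_(j < n) _)%N.
have kn : (k <= n)%N.
  rewrite -[leqRHS]card_ord -sum1_card; apply: leq_sum => j _.
  exact: leq_b1.
by have := sqrt_step_anti R k n kn; rewrite /sqrt_step; lra.
Qed.

Lemma norm2_D3 (R : realType) (N : nat) (d : 'cV[R]_N) : d \in D3 R N ->
  norm2 d = Num.sqrt (\sum_(l < N) (d l ord0 != 0%R))%N%:R.
Proof.
rewrite mem_D3 => /forallP dD; rewrite /norm2 natr_sum.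
congr Num.sqrt; apply: eq_bigr => l _; have := dD l.
rewrite !inE => /or3P[] /eqP ->; rewrite ?sqrrN ?expr1n ?expr0n ?eqxx //.
  by rewrite oppr_eq0 oner_eq0.
by rewrite oner_eq0.
Qed.

Lemma cosine_lower_bound (R : realType) (N : nat) (v : 'cV[R]_N) (m : R) :
  v != 0 -> (forall d, d \in D3 R N -> d != 0 -> cosine v d <= m) ->
  1 / Num.sqrt (\sum_(j < N) sqrt_step R j ^+ 2) <= m.
Proof.
case: N v => [|n] v v0 hm; first by case/eqP: v0; apply/colP => -[].
have [s s_anti] := sorting_perm R n.+1 (fun l => `|v l ord0|).
(* Indexed by [nat] to fit [abel_sum_ge]; only the values at k <= n matter. *)
pose a (k : nat) := `|v (s (inord k)) ord0|.
pose M := m * norm2 v.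
have a_ge0 k : 0 <= a k by exact: normr_ge0.
have a_sum k : (k <= n.+1)%N -> \sum_(j < k) a j <= M * Num.sqrt k%:R.
  case: k => [|k] kn; first by rewrite big_ord0 sqrtr0 mulr0.
  (* The value 1 at 0 gives [d] exactly k + 1 nonzero entries, even where [v] vanishes. Below,
     [(s^-1)%g l] is the rank of the entry [l]. *)
  pose sign (x : R) : R := if 0 <= x then 1 else -1.
  pose d : 'cV[R]_n.+1 :=
    \col_l (if ((s^-1)%g l < k.+1)%N then sign (v l ord0) else 0).
  have dD : d \in D3 R n.+1.
    rewrite mem_D3; apply/forallP => l; rewrite mxE /sign !inE.
    by do 2?[case: ifP => _]; rewrite eqxx ?orbT.
  have sign0 x : sign x != 0.
    by rewrite /sign; case: ifP => _; rewrite ?oppr_eq0 oner_eq0.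
  have d0 : d != 0.
    apply/eqP => /colP/(_ (s ord0)); rewrite !mxE permK /=.
    exact/eqP.
  have nd : norm2 d = Num.sqrt k.+1%:R.
    rewrite norm2_D3 //; congr (Num.sqrt _%:R).
    rewrite (reindex_inj (@perm_inj _ s)) /=.
    rewrite -[RHS]card_ord -sum1_card (big_ord_widen _ (fun=> 1%N) kn).
    rewrite [RHS]big_mkcond; apply: eq_bigr => i _; rewrite mxE permK.
    by case: ifP => _; rewrite ?sign0 ?eqxx.
  have dvd : dot v d = \sum_(j < k.+1) a j.
    rewrite dotE (reindex_inj (@perm_inj _ s)) /=.
    rewrite (big_ord_widen _ a kn) [RHS]big_mkcond.
    apply: eq_bigr => i _; rewrite mxE permK /a inord_val.
    case: ifP => _; last by rewrite mulr0.
    rewrite /sign; case: ifPn => [/ger0_norm->|]; first by rewrite mulr1.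
    by rewrite -ltNge => /ltr0_norm ->; rewrite mulrN1.
  have := hm d dD d0; rewrite /cosine ler_pdivrMr ?mulr_gt0 ?norm2_gt0 //.
  by rewrite dvd nd mulrA.
have v_gt0 := norm2_gt0 R _ _ v0.
(* The case k = 1 gives 0 <= a_1 <= M. The sign of [m] is needed to compare squares at the end. *)
have m_ge0 : 0 <= m.
  have := a_sum 1%N isT; rewrite big_ord1 sqrtr1 mulr1 => aM.
  by rewrite -(pmulr_lge0 _ v_gt0) (le_trans (a_ge0 0%N)).
pose c := sqrt_step R.
have e_ge0 k : (k <= n.+1)%N -> 0 <= \sum_(j < k) (M * c j - a j).
  by move=> kn; rewrite sumrB -mulr_sumr sum_sqrt_step subr_ge0 a_sum.
have abel : 0 <= \sum_(j < n.+1) (M * c j - a j) * a j.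
  apply: le_trans (abel_sum_ge R (fun j => M * c j - a j) a n _ _).
  - by rewrite mulr_ge0 ?e_ge0.
  - by move=> k kn; apply: s_anti; rewrite !inordK // ltnW.
  - by move=> k kn; apply: e_ge0; rewrite leqW.
have a_sq : \sum_(j < n.+1) a j ^+ 2 = norm2 v ^+ 2.
  rewrite sqr_sqrtr ?sumr_ge0 // => [|i _]; last exact: sqr_ge0.
  rewrite [RHS](reindex_inj (@perm_inj _ s)) /=; apply: eq_bigr => i _.
  by rewrite /a inord_val real_normK ?num_real.
set S := \sum_(j < _) _.
have Mc : norm2 v ^+ 2 <= M ^+ 2 * S.
  have sq_ge0 : 0 <= \sum_(j < n.+1) (M * c j - a j) ^+ 2.
    by apply: sumr_ge0 => j _; exact: sqr_ge0.
  rewrite -subr_ge0 -a_sq /S mulr_sumr -sumrB.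
  (* Termwise x^2 - y^2 = (x - y)^2 + 2 (x - y) y, with the last sum controlled by [abel]. *)
  have -> : \sum_(j < n.+1) (M ^+ 2 * c j ^+ 2 - a j ^+ 2) =
      \sum_(j < n.+1) (M * c j - a j) ^+ 2 +
      (\sum_(j < n.+1) (M * c j - a j) * a j) *+ 2.
    by rewrite -sumrMnl -big_split; apply: eq_bigr => j _ /=; ring.
  by rewrite addr_ge0 ?mulrn_wge0.
have S_ge0 : 0 <= S by apply: sumr_ge0 => j _; exact: sqr_ge0.
have mS : 1 <= m ^+ 2 * S.
  rewrite -(ler_pM2r (exprn_gt0 2 v_gt0)) mul1r.
  by rewrite mulrAC -exprMn.
have S_gt0 : 0 < S.
  rewrite lt_neqAle S_ge0 andbT; apply/eqP => S0.
  by move: mS; rewrite -S0 mulr0 ler10.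
rewrite ler_pdivrMr ?sqrtr_gt0 //.
rewrite -(@ler_pXn2r _ 2) ?nnegrE ?mulr_ge0 ?sqrtr_ge0 //.
by rewrite exprMn sqr_sqrtr // expr1n.
Qed.

(** Rules out the junk value of [set_max]: the set is finite, and nonempty thanks to the all-ones
    vector, which is nonzero as N > 0. *)
Lemma set_max_attained (R : realType) (N : nat) (v : 'cV[R]_N) :
  (0 < N)%N ->
  let A := [set cosine v d | d in [set d | d \in D3 R N /\ d != 0]] in
  A (set_max A) /\ ubound A (set_max A).
Proof.
move=> N_gt0 A.
have D1 : const_mx 1 \in D3 R N.
  by rewrite mem_D3; apply/forallP => l; rewrite mxE !inE eqxx !orbT.
have one0 : const_mx 1 != 0 :> 'cV[R]_N.
  apply/eqP => /colP/(_ (Ordinal N_gt0)); rewrite !mxE.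
  exact/eqP/oner_neq0.
pose P := [pred d : D3 R N | val d != 0].
have [d Pd dmax] := @arg_maxP _ R _ [` D1]%fset P (cosine v \o val) one0.
have ubA : ubound A (cosine v (val d)).
  by move=> _ [e [eD e0] <-]; exact: (dmax [` eD]%fset).
have memA : A (cosine v (val d)).
  by exists (val d) => //; split => //; exact: valP.
by rewrite (set_maxE R A _ memA ubA).
Qed.

Theorem theorem3 (R : realType) (N : nat) (hN : (1 <= N)%N) :
  cm (D3 R N) =
  1 / Num.sqrt (\sum_(1 <= j < N.+1)
                  (Num.sqrt (j%:R : R) - Num.sqrt (j%:R - 1)) ^+ 2).
Proof.
rewrite big_add1 big_mkord.
under eq_bigr do rewrite -[in X in _ - Num.sqrt X]natr1 addrK -/(sqrt_step R _).
set S := \sum_(j < _) _.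
have lb (v : 'cV[R]_N) : v != 0 -> 1 / Num.sqrt S <=
    set_max [set cosine v d | d in [set d | d \in D3 R N /\ d != 0]].
  move=> v0; apply: (cosine_lower_bound R N v) => // d dD d0.
  have [_] := set_max_attained R N v hN; apply.
  by exists d.
apply: set_minE; last by move=> _ [v v0 <-]; exact: lb.
pose c : 'cV[R]_N := \col_l sqrt_step R l.
have c0 : c != 0.
  apply/eqP => /colP/(_ (Ordinal hN)); rewrite !mxE /sqrt_step sqrtr0 subr0.
  by rewrite sqrtr1; exact/eqP/oner_neq0.
(* By [lb], only the upper bound on the maximal cosine of [c] remains; with |c| = sqrt S it reduces
   to c^T d <= |d|. *)
exists c => //; apply/le_anti; rewrite lb // andbT.
have [[d [dD d0] <-] _] := set_max_attained R N c hN.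
have nc : norm2 c = Num.sqrt S.
  by congr Num.sqrt; apply: eq_bigr => l _; rewrite mxE.
rewrite /cosine -nc.
have nc0 := norm2_gt0 R N c c0; have nd0 := norm2_gt0 R N d d0.
rewrite ler_pdivrMr ?mulr_gt0 // div1r mulKf ?gt_eqF //.
(* The support of [d] as a predicate on [nat]; the default index is reached only for l >= N, outside
   the sums. *)
pose P (l : nat) := d (insubd (Ordinal hN) l) ord0 != 0.
have PE (l : 'I_N) : P l = (d l ord0 != 0) by rewrite /P valKd.
rewrite norm2_D3 //; under eq_bigr do rewrite -PE.
apply: le_trans (sum_sqrt_step_le R P N).
(* Termwise comparison; an entry -1 of [d] contributes a nonpositive term because the steps are
   nonnegative. *)
rewrite dotE [leRHS]big_mkcond; apply: ler_sum => l _; rewrite PE mxE.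
have := sqrt_step_ge0 R l.
move: dD; rewrite mem_D3 => /forallP/(_ l).
rewrite !inE => /or3P[] /eqP ->; rewrite ?mulr0 ?mulr1 ?eqxx ?oner_eq0 //.
by rewrite oppr_eq0 oner_eq0 mulrN1 => x0; rewrite (le_trans _ x0) ?oppr_le0.
Qed.
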